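(* For every $n\ge2$, given the edge counts $(m_t)_{t\ge1}$, the vector $\bigl(N_{>k}(n)\bigr)_{k\ge1}$ is a statistically sufficient statistic for the parameter $\delta$ based on the observation $D^{(n)}$; that is, it is sufficient for the family, indexed by $\delta>-1$, of conditional laws of $D^{(n)}$ given $(m_t)_{t\ge1}$.
   Context: Initial degrees. $(m_t)_{t\ge1}$ is an i.i.d. sequence of positive-integer-valued random variables whose distribution does not depend on $\delta$. $M_t=\sum_{j=1}^t m_j$. Model (affine preferential attachment with random initial degrees, parameter $\delta>-1$). $\mathrm{PA}_1(\delta)$ has two vertices $v_0,v_1$ joined by $m_1$ edges. For $t\ge2$, given $\mathrm{PA}_{t-1}(\delta)=:\mathrm{PA}_{t,0}(\delta)$ with vertex set $V_{t-1}=\{v_0,\dots,v_{t-1}\}$, a new vertex $v_t$ is added, and sequentially for $i=1,\dots,m_t$ the network $\mathrm{PA}_{t,i}(\delta)$ is obtained from $\mathrm{PA}_{t,i-1}(\delta)$ by adding an edge between $v_t$ and a random vertex of $V_{t-1}$, where (conditionally on the past and on $(m_t)_{t\ge1}$) vertex $v_j\in V_{t-1}$ is chosen with probability $(\mathrm{Deg}_{t,i-1}(v_j)+\delta)/S_{t,i-1}(\delta)$. Here $\mathrm{Deg}_{t,i-1}(v)$ is the degree of $v$ in $\mathrm{PA}_{t,i-1}(\delta)$ and $S_{t,i-1}(\delta)=\sum_{v\in V_{t-1}}(\mathrm{Deg}_{t,i-1}(v)+\delta)=t\delta+2M_{t-1}+(i-1)$. Finally $\mathrm{PA}_t(\delta)=\mathrm{PA}_{t,m_t}(\delta)$.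 Observation. $D_{t,i}$ is the degree in $\mathrm{PA}_{t,i-1}(\delta)$ of the vertex chosen when constructing $\mathrm{PA}_{t,i}(\delta)$ from $\mathrm{PA}_{t,i-1}(\delta)$; $D_t=(D_{t,1},\dots,D_{t,m_t})$ and $D^{(n)}=(D_t)_{t=2}^n$. $N_k(t,i-1)$ is the number of vertices in $V_{t-1}$ (not counting $v_t$) of degree $k$ in $\mathrm{PA}_{t,i-1}(\delta)$. The conditional likelihood is $$\mathbb{P}\bigl((D_t)_{t=2}^n=(d_t)_{t=2}^n\mid(m_t)_{t\ge1}\bigr)=\prod_{t=2}^n\prod_{i=1}^{m_t}\frac{(d_{t,i}+\delta)N_{d_{t,i}}(t,i-1)}{S_{t,i-1}(\delta)}.$$ $N_k(n)$ is the number of vertices of degree $k$ in $\mathrm{PA}_n(\delta)$ (all vertices counted) and $N_{>k}(n)=\sum_{j>k}N_j(n)$; given $(m_t)$, it is a function of $D^{(n)}$. *)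

(* Defs.v *)
From HB Require Import structures.
From mathcomp Require Import all_boot all_order all_algebra.
From mathcomp Require Import all_classical all_reals all_analysis.

Set Implicit Arguments.
Unset Strict Implicit.
Unset Printing Implicit Defensive.

Import Order.TTheory GRing.Theory Num.Theory.
Import numFieldNormedType.Exports.

Local Open Scope classical_set_scope.
Local Open Scope ring_scope.

(** * Networks

  A network is the list of its edges; vertex [v_j] is the number [j].
  Throughout, [m] is the sequence of edge counts and [v t i] is the index of
  the vertex joined to [v_t] by its [i]-th edge.  As in the usual notation,
  [m] is indexed by [t >= 1], and [v t i] is used only for [t >= 2] and
  [1 <= i <= m t]; the values outside these ranges are never read. *)

Definition network := seq (nat * nat).

Definition deg (g : network) (j : nat) : nat :=
  (\sum_(e <- g) ((e.1 == j) + (e.2 == j)))%N.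

(* [PA m v t] is PA_t; its vertices are 0, ..., t. *)
Fixpoint PA (m : nat -> nat) (v : nat -> nat -> nat) (t : nat) : network :=
  match t with
  | 0 => [::]
  | 1 => nseq (m 1%N) (0%N, 1%N)
  | s.+1 => PA m v s ++ [seq (s.+1, v s.+1 i) | i <- iota 1 (m s.+1)]
  end.

(* [PAstep m v t i] is PA_{t,i}, for t >= 2: PA_{t-1} and the first [i] edges
   of [v_t]. *)
Definition PAstep (m : nat -> nat) (v : nat -> nat -> nat) (t i : nat) :
    network :=
  PA m v t.-1 ++ [seq (t, v t l) | l <- iota 1 i].

(* D_{t,i} *)
Definition chosen_degree (m : nat -> nat) (v : nat -> nat -> nat)
    (t i : nat) : nat :=
  deg (PAstep m v t i.-1) (v t i).

(* D^(n), as the list of the lists D_2, ..., D_n *)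
Definition observation (n : nat) (m : nat -> nat) (v : nat -> nat -> nat) :
    seq (seq nat) :=
  [seq [seq chosen_degree m v t i | i <- iota 1 (m t)] | t <- iota 2 n.-1].

(* N_k(n) *)
Definition num_deg (n : nat) (m : nat -> nat) (v : nat -> nat -> nat)
    (k : nat) : nat :=
  count (fun j => deg (PA m v n) j == k) (iota 0 n.+1).

(* N_{>k}(n).  The sum of N_j(n) over j > k stops at the sum of all degrees,
   which is twice the number of edges. *)
Definition num_deg_gt (n : nat) (m : nat -> nat) (v : nat -> nat -> nat)
    (k : nat) : nat :=
  (\sum_(k.+1 <= j < (size (PA m v n)).*2.+1) num_deg n m v j)%N.

(* Deg_{t,i}(v_j) + delta over S_{t,i}(delta) *)
Definition PAweight (R : realType) (delta : R) (m : nat -> nat)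
    (v : nat -> nat -> nat) (t i j : nat) : R :=
  ((deg (PAstep m v t i) j)%:R + delta) /
  \sum_(l < t) ((deg (PAstep m v t i) l)%:R + delta).

(** * Conditional probabilities and sufficiency *)

(* [f] is a version of P(E | F), for a sub-sigma-algebra [F]. *)
Definition is_cond_prob d (T : measurableType d) (R : realType)
    (P : probability T R) (F : set (set T)) (E : set T) (f : T -> R) : Prop :=
  [/\ forall B : set R, measurable B -> F (f @^-1` B),
      P.-integrable setT (EFin \o f) &
      forall A, F A -> (\int[P]_(w in A) (f w)%:E = P (A `&` E))%E].

(* the events {m_t = k}, t >= 1 *)
Definition count_events T (m : nat -> T -> nat) : set (set T) :=
  [set A | exists t k, (0 < t)%N /\ A = [set w | m t w = k]].

(* the events {S_k = j} *)
Definition stat_events T (S : nat -> T -> nat) : set (set T) :=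
  [set A | exists k j, A = [set w | S k w = j]].

(* [X] is the observation, with values in the countable type [C], and
   [S = (S_0, S_1, ...)] a candidate statistic; everything is conditional on
   [(m_t)_{t >= 1}].  [S] is sufficient for the family, indexed by
   [theta] in [Theta], of the conditional laws of [X] given [(m_t)] under
   [P theta] when it is a function of [X] (given [(m_t)]) and the conditional
   law of [X] given [S] under these laws, that is, the conditional law of [X]
   given [(m_t)] and [S] under [P theta], does not depend on [theta]: there is
   a stochastic kernel [K] that is a version of it for all [theta] at once. *)
Definition sufficient_given d (T : measurableType d) (R : realType)
    (C : countType) (Theta : set R) (P : R -> probability T R)
    (m : nat -> T -> nat) (X : T -> C) (S : nat -> T -> nat) : Prop :=
  (exists tau : (nat -> nat) -> C -> nat -> nat,
     forall w k, S k w = tau (fun t => m t.+1 w) (X w) k) /\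
  (exists K : T -> C -> R,
     [/\ forall w x, 0 <= K w x,
         forall w, (\esum_(x in [set: C]) (K w x)%:E = 1)%E &
         forall theta, Theta theta -> forall x,
           is_cond_prob (P theta)
             <<s count_events m `|` stat_events S >>
             [set w | X w = x] (fun w => K w x)]).

(** * The random model *)

(* [(m_t)_{t >= 1}] is i.i.d. with law [mu] under [P]. *)
Definition iid_counts d (T : measurableType d) (R : realType)
    (P : probability T R) (mu : probability nat R) (m : nat -> T -> nat) :
    Prop :=
  forall (n : nat) (B : nat -> set nat),
    (P [set w | forall t, (0 < t <= n)%N -> B t (m t w)] =
     \prod_(1 <= t < n.+1) mu (B t))%E.

(* The sigma-algebra generated by [(m_t)_{t >= 1}] and by the choices made
   before the [i]-th one of [v_t]. *)
Definition past d (T : measurableType d) (m : nat -> T -> nat)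
    (v : nat -> nat -> T -> nat) (t i : nat) : set (set T) :=
  <<s count_events m `|`
      [set A | exists s l j,
         [/\ (1 < s)%N, (0 < l)%N, (s < t)%N \/ s = t /\ (l < i)%N &
             A = [set w | (l <= m s w)%N /\ v s l w = j]]] >>.

(* Conditionally on the past and on [(m_t)], the [i]-th edge of [v_t], if
   there is one, goes to [v_j] with probability
   (Deg_{t,i-1}(v_j) + delta) / S_{t,i-1}(delta). *)
Definition affine_PA d (T : measurableType d) (R : realType)
    (P : probability T R) (delta : R) (m : nat -> T -> nat)
    (v : nat -> nat -> T -> nat) : Prop :=
  forall t i j, (1 < t)%N -> (0 < i)%N -> (j < t)%N ->
    is_cond_prob P (past m v t i)
      [set w | (i <= m t w)%N /\ v t i w = j]
      (fun w => if (i <= m t w)%N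
                then PAweight delta (m ^~ w) (fun s l => v s l w) t i.-1 j
                else 0).

(* Main.v *)
Require Import Defs.
From HB Require Import structures.
From mathcomp Require Import all_boot all_order all_algebra.
From mathcomp Require Import all_classical all_reals all_analysis.
From mathcomp Require Import zify measurable_realfun.

(** Given the edge counts, a sequence of chosen vertices has probability
  [prod (D_{t,i} + delta) / prod S_{t,i-1}(delta)]: the denominator depends only
  on the edge counts, the numerator only on the multiset of the observed
  degrees.  An old vertex passes from degree [k] to [k + 1] exactly when it is
  chosen at degree [k], and [v_t] enters with degree [m_t]; hence [N_{>k}(n)] is
  the number of [D_{t,i}] equal to [k] plus the number of initial degrees above
  [k], which is a function of the edge counts, and the vector
  [(N_{>k}(n))_{k >= 1}] carries the same information as that multiset.  So,
  given the edge counts and this vector, the chosen vertices are uniformly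
  distributed on a finite set that does not depend on [delta], and the kernel is
  the image of this uniform law under the observation. *)

Set Implicit Arguments.
Unset Strict Implicit.
Unset Printing Implicit Defensive.

Import Order.TTheory GRing.Theory Num.Theory.
Import numFieldNormedType.Exports.

Local Open Scope classical_set_scope.
Local Open Scope ring_scope.

(** * Degrees along a sequence of choices *)

(** Equality on just the entries from which the network at time [n] is built; all other values may
    differ. *)
Definition agree (n : nat) (a b : nat -> nat) (u v : nat -> nat -> nat) : Prop :=
  (forall t, (0 < t <= n)%N -> a t = b t) /\
  (forall t i, (1 < t <= n)%N -> (0 < i <= a t)%N -> u t i = v t i).

Lemma agreeW n p a b u v : (p <= n)%N -> agree n a b u v -> agree p a b u v.
Proof.
move=> pn [ab uv]; split=> [t /andP[t0 tp]|t i /andP[t1 tp] hi].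
  by apply: ab; rewrite t0 (leq_trans tp).
by apply: uv => //; rewrite t1 (leq_trans tp).
Qed.

Lemma PAE m v t : (1 < t)%N -> PA m v t = PAstep m v t (m t).
Proof. by case: t => [//|[//|t]] _. Qed.

Lemma eq_PA n a b u v : agree n a b u v -> PA a u n = PA b v n.
Proof.
elim: n => [//|[|n] IH] abuv; first by rewrite /= (proj1 abuv).
rewrite !PAE // /PAstep -(proj1 abuv n.+2) ?leqnn //.
rewrite (IH (agreeW (leqnSn _) abuv)); congr (_ ++ _).
apply/eq_in_map => i; rewrite mem_iota add1n ltnS => hi.
by rewrite (proj2 abuv) // leqnn.
Qed.

Lemma eq_PAstep t i a b u v : agree t.-1 a b u v ->
  (forall l, (0 < l <= i)%N -> u t l = v t l) ->
  PAstep a u t i = PAstep b v t i.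
Proof.
move=> abuv uv; rewrite /PAstep (eq_PA abuv); congr (_ ++ _).
by apply/eq_in_map => l; rewrite mem_iota add1n ltnS => /uv ->.
Qed.

Lemma eq_observation n a b u v : agree n a b u v ->
  observation n a u = observation n b v.
Proof.
move=> abuv; apply/eq_in_map => t; rewrite mem_iota => /andP[t1 tn].
have tn' : (t <= n)%N by move: t1 tn; case: n {abuv} => [|n] /=; lia.
rewrite -(proj1 abuv) ?(ltnW t1) //; apply/eq_in_map => i.
rewrite mem_iota add1n ltnS => hi; rewrite /chosen_degree.
have uvt l : (0 < l <= a t)%N -> u t l = v t l.
  by move=> hl; rewrite (proj2 abuv) // t1.
rewrite uvt // (@eq_PAstep _ _ _ b _ v) //.
  by apply: agreeW abuv; lia.
by move=> l hl; apply: uvt; lia.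
Qed.

Lemma eq_num_deg_gt n a b u v : agree n a b u v ->
  num_deg_gt n a u =1 num_deg_gt n b v.
Proof. by move=> abuv k; rewrite /num_deg_gt /num_deg (eq_PA abuv). Qed.

Lemma deg_cat g h j : deg (g ++ h) j = (deg g j + deg h j)%N.
Proof. exact: big_cat. Qed.

Lemma PAstepS m v t i :
  PAstep m v t i.+1 = PAstep m v t i ++ [:: (t, v t i.+1)].
Proof. by rewrite /PAstep -[in LHS](addn1 i) iotaD map_cat add1n catA. Qed.

Lemma PAstep0 m v t : PAstep m v t.+1 0 = PA m v t.
Proof. exact: cats0. Qed.

Lemma degS m v t i j : (j < t)%N ->
  deg (PAstep m v t i.+1) j = (deg (PAstep m v t i) j + (v t i.+1 == j))%N.
Proof.
move=> jt; rewrite PAstepS deg_cat; congr addn.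
by rewrite /deg big_seq1 /= gtn_eqF.
Qed.

Lemma size_PA m v t : size (PA m v t) = (\sum_(1 <= s < t.+1) m s)%N.
Proof.
elim: t => [|[|t] IH]; first by rewrite big_geq.
  by rewrite /= size_nseq big_nat1.
by rewrite PAE // size_cat size_map size_iota /= IH [in RHS]big_nat_recr.
Qed.

Lemma observationS n m v : (0 < n)%N ->
  observation n.+1 m v =
  observation n m v ++ [:: [seq chosen_degree m v n.+1 i | i <- iota 1 (m n.+1)]].
Proof.
case: n => // n _; rewrite /observation [n.+2.-1]/= -[in LHS](addn1 n) iotaD.
by rewrite map_cat /= add2n.
Qed.

Section Choices.
Variables (m : nat -> nat) (v : nat -> nat -> nat).
Hypothesis v_lt : forall t i, (1 < t)%N -> (v t i < t)%N.

Lemma PA_le t e : e \in PA m v t -> (e.1 <= t)%N /\ (e.2 <= t)%N.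
Proof.
elim: t => [//|[|t] IH]; first by move=> /nseqP[-> _].
rewrite PAE // mem_cat => /orP[/IH[h1 h2]|]; first by split; apply: leqW.
by case/mapP => i _ -> /=; split => //; exact/ltnW/v_lt.
Qed.

Lemma deg_PA_gt t j : (t < j)%N -> deg (PA m v t) j = 0%N.
Proof.
move=> tj; rewrite /deg big_seq big1 // => e /PA_le[h1 h2].
by rewrite !ltn_eqF // (leq_ltn_trans _ tj).
Qed.

Lemma deg_PAstep_new t i : (1 < t)%N -> deg (PAstep m v t i) t = i.
Proof.
case: t => // t t1; elim: i => [|i IH]; first by rewrite PAstep0 deg_PA_gt.
rewrite PAstepS deg_cat IH /deg big_seq1 /= eqxx ltn_eqF ?addn1 //.
exact: v_lt.
Qed.

Lemma sum_deg_PA t : (\sum_(j < t.+1) deg (PA m v t) j)%N = (size (PA m v t)).*2.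
Proof.
rewrite /deg exchange_big -mul2n mulnC -sum1_size big_distrl [LHS]big_seq.
rewrite [RHS]big_seq; apply: eq_bigr => e /PA_le[h1 h2].
have one k : (k <= t)%N -> (\sum_(i < t.+1) (k == i))%N = 1%N.
  rewrite -ltnS => kt; rewrite (bigD1 (Ordinal kt)) //= eqxx big1 // => i.
  by rewrite -val_eqE /= eq_sym => /negbTE ->.
by rewrite big_split /= !one.
Qed.

(** Only old vertices are summed, so each edge of the new vertex counts once, through its chosen
    end. This gives the degree part of the normalizing sum. *)
Lemma sum_deg_PAstep t i : (0 < t)%N ->
  (\sum_(j < t.+1) deg (PAstep m v t.+1 i) j)%N = ((size (PA m v t)).*2 + i)%N.
Proof.
move=> t0; elim: i => [|i IH]; first by rewrite PAstep0 sum_deg_PA addn0.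
under eq_bigr do rewrite degS //.
rewrite big_split /= IH -addnA -[in RHS]addn1; congr (_ + (_ + _))%N.
have vt : (v t.+1 i.+1 < t.+1)%N by exact: v_lt.
rewrite (bigD1 (Ordinal vt)) //= eqxx big1 // => j.
by rewrite -val_eqE /= eq_sym => /negbTE ->.
Qed.

Lemma leq_deg_size g j : (deg g j <= (size g).*2)%N.
Proof.
rewrite /deg -mul2n mulnC -sum1_size big_distrl; apply: leq_sum => e _.
by case: (_ == _); case: (_ == _).
Qed.

(** After exchanging the sums, each vertex is seen only at the level equal to its degree. The upper
    bound cuts off nothing, since no degree exceeds twice the number of edges. *)
Lemma num_deg_gtE n k :
  num_deg_gt n m v k = (\sum_(j < n.+1) (k < deg (PA m v n) j))%N.
Proof.
rewrite /num_deg_gt /num_deg.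
under eq_bigr do rewrite -sum1_count big_mkcond.
rewrite exchange_big -[iota _ _]/(index_iota 0 n.+1) big_mkord /=.
apply: eq_bigr => j _; rewrite -big_mkcond /= sum1_count.
have := leq_deg_size (PA m v n) j; set D := deg _ _ => DE.
have -> : count (fun i => D == i) (index_iota k.+1 (size (PA m v n)).*2.+1)
    = count_mem D (index_iota k.+1 (size (PA m v n)).*2.+1).
  by apply: eq_count => i; rewrite eq_sym.
by rewrite count_uniq_mem ?iota_uniq // mem_index_iota ltnS DE andbT.
Qed.

(** The vertex [t] is left out while its edges are drawn; it enters afterwards, with its final
    initial degree [m t]. *)
Definition num_gt t i k := (\sum_(j < t) (k < deg (PAstep m v t i) j))%N.

(** Only the chosen vertex changes degree, from [D] to [D + 1], and this crosses level [k] exactly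
    when [D = k]. *)
Lemma num_gtS t i k : (1 < t)%N ->
  num_gt t i.+1 k = (num_gt t i k + (chosen_degree m v t i.+1 == k))%N.
Proof.
move=> t1; rewrite /num_gt; under eq_bigr do rewrite degS //.
pose j0 := Ordinal (v_lt i.+1 t1).
rewrite (bigD1 j0) //= [in RHS](bigD1 j0) //= eqxx /chosen_degree /=.
rewrite [RHS]addnAC; congr (_ + _)%N; last first.
  apply: eq_bigr => j; rewrite -val_eqE /= eq_sym => /negbTE ->.
  by rewrite addn0.
by set D := deg _ _; lia.
Qed.

Lemma num_gt_new t k : (1 < t)%N ->
  num_gt t.+1 0 k = (num_gt t (m t) k + (k < m t))%N.
Proof.
by move=> t1; rewrite /num_gt big_ord_recr /= PAstep0 PAE // deg_PAstep_new.
Qed.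

Lemma num_gt_steps t i k : (1 < t)%N -> num_gt t i k =
  (num_gt t 0 k + count_mem k [seq chosen_degree m v t l | l <- iota 1 i])%N.
Proof.
move=> t1; elim: i => [|i IH]; first by rewrite addn0.
rewrite num_gtS // IH -[in RHS](addn1 i) iotaD map_cat count_cat /= add1n addn0.
by rewrite addnA.
Qed.

(** The contribution of the degrees at entry; the first term is doubled because [v_0] and [v_1] both
    start with degree [m 1]. *)
Definition num_initial_gt n k :=
  ((k < m 1).*2 + \sum_(2 <= t < n.+1) (k < m t))%N.

Lemma num_deg_gt_observation n k : (0 < n)%N ->
  num_deg_gt n m v k =
  (num_initial_gt n k + count_mem k (flatten (observation n m v)))%N.
Proof.
(* The final network is read as the one just before the first edge of the next vertex, so that every
   vertex present counts as old. *)
case: n => // n _; rewrite num_deg_gtE -PAstep0 -/(num_gt n.+2 0 k).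
elim: n => [|n IH].
  rewrite /num_gt PAstep0 /num_initial_gt big_geq //= !big_ord_recr big_ord0 /=.
  have deg1 j : (j <= 1)%N -> deg (nseq (m 1) (0, 1)%N) j = m 1%N.
    move=> j1; elim: (m 1%N) => [|p IH]; first by rewrite /deg big_nil.
    have := IH; rewrite /deg big_cons /= => ->.
    by case: j j1 {IH} => [|[]].
  by rewrite !deg1 // addn0 addnn addn0.
rewrite num_gt_new // num_gt_steps // IH /num_initial_gt.
rewrite [in RHS]big_nat_recr // (@observationS n.+1) // flatten_cat count_cat /= cats0.
lia.
Qed.

Hypothesis m_gt0 : forall t, (0 < t)%N -> (0 < m t)%N.

Lemma deg_PA_gt0 t j : (0 < t)%N -> (j <= t)%N -> (0 < deg (PA m v t) j)%N.
Proof.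
elim: t => [//|[|t] IH] _ jt.
  have -> : PA m v 1 = (0, 1)%N :: nseq (m 1%N).-1 (0, 1)%N.
    by have := m_gt0 (ltn0Sn 0); rewrite /=; case: (m 1%N).
  by rewrite /deg big_cons; case: j jt {IH} => [|[|]].
rewrite PAE //; move: jt; rewrite leq_eqVlt => /predU1P[->|jt].
  by rewrite deg_PAstep_new // m_gt0.
by rewrite /PAstep deg_cat ltn_addr // IH.
Qed.

Lemma chosen_degree_gt0 t i : (1 < t)%N -> (0 < chosen_degree m v t i)%N.
Proof.
case: t => // t t1; rewrite /chosen_degree /PAstep deg_cat ltn_addr //.
by rewrite deg_PA_gt0 // -ltnS v_lt.
Qed.

(** The statistic starts at level 1, so the multiplicity of 0 must be known separately: positive
    edge counts leave no vertex of degree 0 to choose. *)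
Lemma observation_gt0 n : count_mem 0 (flatten (observation n m v)) = 0%N.
Proof.
apply/count_memPn/flattenP => -[s /mapP[t]]; rewrite mem_iota => /andP[t1 _] ->.
by case/mapP => i _ e0; have := chosen_degree_gt0 i t1; rewrite -e0.
Qed.

End Choices.

Lemma perm_observationP n a b u v : (0 < n)%N ->
  (forall t i, (1 < t)%N -> (u t i < t)%N) ->
  (forall t i, (1 < t)%N -> (v t i < t)%N) ->
  (forall t, (0 < t)%N -> (0 < a t)%N) ->
  (forall t, (0 < t)%N -> (0 < b t)%N) ->
  (forall t, (0 < t <= n)%N -> a t = b t) ->
  perm_eq (flatten (observation n a u)) (flatten (observation n b v)) <->
  forall k, num_deg_gt n a u k.+1 = num_deg_gt n b v k.+1.
Proof.
move=> n0 ult vlt a0 b0 ab.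
have init k : num_initial_gt a n k = num_initial_gt b n k.
  rewrite /num_initial_gt ab //; congr addn; rewrite !big_nat.
  by apply: eq_bigr => t /andP[t1 tn]; rewrite ab // (ltnW t1).
split=> [/permP pe k|H].
  by rewrite !num_deg_gt_observation // init pe.
apply/allP => k _ /=; case: k => [|k]; first by rewrite !observation_gt0.
by move: (H k); rewrite !num_deg_gt_observation // init => /addnI ->.
Qed.

(** The factorization of the likelihood: [delta] meets the choices only through the multiset of
    observed degrees, since the degree sum makes each denominator a function of the counts. *)
Lemma PAweight_observation (R : realType) (delta : R) n m v :
  (forall t i, (1 < t)%N -> (v t i < t)%N) -> (0 < n)%N ->
  \prod_(2 <= t < n.+1) \prod_(1 <= i < (m t).+1)
    PAweight delta m v t i.-1 (v t i) =
  (\prod_(k <- flatten (observation n m v)) (k%:R + delta)) *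
  \prod_(2 <= t < n.+1) \prod_(1 <= i < (m t).+1)
    (((\sum_(1 <= s < t) m s).*2 + i.-1)%:R + t%:R * delta)^-1.
Proof.
move=> vlt n0; rewrite big_flatten /= big_map.
have -> : iota 2 n.-1 = index_iota 2 n.+1.
  by case: n n0 => // n _; rewrite /index_iota subSS subn1.
rewrite -big_split /= big_nat [RHS]big_nat; apply: eq_bigr => t /andP[t1 _].
rewrite big_map.
have -> : iota 1 (m t) = index_iota 1 (m t).+1 by rewrite /index_iota subSS subn0.
rewrite -big_split /=; apply: eq_bigr => i _; congr (_ / _).
case: t t1 => // t t1; rewrite big_split /= sumr_const card_ord.
rewrite -[delta *+ _]mulr_natl.
by rewrite -natr_sum sum_deg_PAstep // size_PA.
Qed.

(** * Sigma-algebras and uniform laws *)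

Section CountableFactor.
Context d (T : measurableType d) (C : countType) (Y : T -> C).
Hypothesis mY : forall w0, measurable [set w | Y w = Y w0].

Lemma measurable_factor (Q : set T) :
  (forall w w', Y w = Y w' -> Q w -> Q w') -> measurable Q.
Proof.
(* [Q] splits along the codes of the values of [Y] into countably many pieces, each empty or a whole
   fibre of [Y]. *)
move=> QY; pose F k := [set w | Q w /\ pickle (Y w) = k].
have -> : Q = \bigcup_k F k.
  by apply/seteqP; split=> [w Qw|w [k _ []]//]; exists (pickle (Y w)).
apply: bigcupT_measurable => k.
have [[w0 [Qw0 <-]]|Fk0] := pselect (exists w, F k w); last first.
  by rewrite (_ : F k = set0) //; apply/seteqP; split=> // w Fw; case: Fk0; exists w.
rewrite (_ : F _ = [set w | Y w = Y w0]) //; apply/seteqP; split=> w.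
  by case=> _ /(pcan_inj pickleK).
by move=> Yw; split; [exact: QY Qw0|rewrite Yw].
Qed.

End CountableFactor.

Lemma measurable_forall d (T : measurableType d) (Q : nat -> set T) :
  (forall k, measurable (Q k)) -> measurable [set w | forall k, Q k w].
Proof.
move=> mQ; rewrite (_ : mkset _ = \bigcap_k Q k); first exact: bigcapT_measurable.
by apply/seteqP; split=> [w Qw k _|w Qw k]; exact: Qw.
Qed.

Lemma measurable_imply d (T : measurableType d) (p : Prop) (Q : set T) :
  (p -> measurable Q) -> measurable [set w | p -> Q w].
Proof.
move=> mQ; have [hp|np] := pselect p.
  rewrite (_ : mkset _ = Q); first exact: mQ.
  by apply/seteqP; split=> [w|w Qw _] //; apply.
by rewrite (_ : mkset _ = setT) //; apply/seteqP; split=> w // _ /np.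
Qed.

(** The sets whose trace on [Z] is the trace of a set of [<<s G >>] form a sigma-algebra, and it
    contains [H] because each set of [H] misses or covers [Z]. *)
Lemma g_sigma_algebra_trace T (G H : set (set T)) (Z : set T) :
  (forall B, H B -> B `&` Z = set0 \/ Z `<=` B) ->
  forall A, <<s G `|` H >> A -> exists2 B, <<s G >> B & A `&` Z = B `&` Z.
Proof.
move=> HZ; apply: smallest_sub; last first.
  move=> A [GA|/HZ[AZ|AZ]]; first by exists A => //; exact: sub_sigma_algebra.
    exists set0; last by rewrite set0I.
    by case: (smallest_sigma_algebra [set: T] G).
  exists setT; last by rewrite setTI; apply/setIidr.
  case: (smallest_sigma_algebra [set: T] G) => G0 GC _.
  by have := GC _ G0; rewrite setD0.
case: (smallest_sigma_algebra [set: T] G) => G0 GC GU; split.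
- by exists set0.
- move=> A [B GB AB]; exists (setT `\` B); first exact: GC.
  rewrite !setTD; apply/seteqP; split=> w [nw Zw]; split=> // hw; apply: nw.
    by have [] : (A `&` Z) w by rewrite AB.
  by have [] : (B `&` Z) w by rewrite -AB.
- move=> A hA.
  have /choice[B GAB] : forall k, exists B, <<s G >> B /\ A k `&` Z = B `&` Z.
    by move=> k; have [B] := hA k; exists B.
  exists (\bigcup_k B k); first by apply: GU => k; exact: (GAB k).1.
  by rewrite !setI_bigcupl; apply: eq_bigcupr => k _; exact: (GAB k).2.
Qed.

Lemma measure_bigcup_finType d (T : measurableType d) (R : realType)
    (mu : {measure set T -> \bar R}) (I : finType) (p : pred I) (F : I -> set T) :
  (forall i, p i -> measurable (F i)) ->
  (forall i j w, p i -> p j -> F i w -> F j w -> i = j) ->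
  mu (\bigcup_(i in [set i | p i]) F i) = (\sum_(i | p i) mu (F i))%E.
Proof.
move=> mF tF; rewrite measure_fin_bigcup //.
- have -> : [set i | p i] = [set` enum p].
    by apply/seteqP; split=> i /=; rewrite mem_enum.
  by rewrite -fsbig_seq ?enum_uniq // big_enum.
- exact: finite_finset.
- by move=> i j pi pj [w [Fi Fj]]; exact: tF Fi Fj.
Qed.

Section UniformOn.
Context (R : realType) (I : finType) (C : countType) (p : pred I) (f : I -> C).

(** The mass at [x] of the image under [f] of the uniform law on [p]. *)
Definition uniform_pushforward (x : C) : R :=
  (\sum_(i | p i) (f i == x)%:R) / #|p|%:R.

Lemma uniform_pushforward_ge0 x : 0 <= uniform_pushforward x.
Proof. by rewrite divr_ge0 // sumr_ge0. Qed.

Lemma uniform_pushforward_le1 x : uniform_pushforward x <= 1.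
Proof.
rewrite /uniform_pushforward; have [p0|p0] := eqVneq #|p| 0%N.
  by rewrite p0 invr0 mulr0.
rewrite ler_pdivrMr ?ltr0n ?lt0n // mul1r -sum1_card natr_sum.
by apply: ler_sum => i _; case: eqP.
Qed.

Lemma esum_uniform_pushforward : (0 < #|p|)%N ->
  (\esum_(x in [set: C]) (uniform_pushforward x)%:E = 1)%E.
Proof.
move=> p0; under eq_esum => x _ do rewrite /uniform_pushforward mulr_suml -sumEFin.
rewrite esum_sum => [|x i _ _]; last by rewrite lee_fin divr_ge0.
rewrite (eq_bigr (fun=> (#|p|%:R^-1)%:E)) => [|i _].
  rewrite sumEFin sumr_const -[_ *+ _]mulr_natl divff //.
  by rewrite pnatr_eq0 -lt0n.
rewrite -[RHS](@esum_set1 R _ (f i) (fun=> (#|p|%:R^-1)%:E)); last first.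
  by rewrite lee_fin invr_ge0.
rewrite [RHS]esum_mkcond; apply: eq_esum => x _.
case: eqP => [fx|/eqP fx]; first by rewrite mem_set // mul1r.
by rewrite memNset ?mul0r // => xf; move: fx; rewrite xf eqxx.
Qed.

(** [Z] is cut into disjoint pieces of equal mass [q], on each of which [X] is constant, so
    conditional probabilities on [Z] are ratios of cardinals. The value of [q], which is where
    [delta] will sit, cancels. *)
Lemma measure_uniform_pushforward d (T : measurableType d)
    (mu : {finite_measure set T -> \bar R}) (F : I -> set T) (q : \bar R)
    (Z : set T) (X : T -> C) (x : C) :
  (forall i, p i -> measurable (F i)) ->
  (forall i j w, p i -> p j -> F i w -> F j w -> i = j) ->
  (forall i, p i -> mu (F i) = q) ->
  (forall i w, p i -> F i w -> X w = f i) ->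
  Z = \bigcup_(i in [set i | p i]) F i ->
  mu (Z `&` [set w | X w = x]) = ((uniform_pushforward x)%:E * mu Z)%E.
Proof.
move=> mF tF muF XF ZE.
have -> : Z `&` [set w | X w = x]
    = \bigcup_(i in [set i | p i && (f i == x)]) F i.
  rewrite ZE; apply/seteqP; split=> [w [[i pi Fi] <-]|w [i /= /andP[pi /eqP <-] Fi]].
    by exists i => //=; rewrite pi (XF i w) ?eqxx.
  by split; [exists i|exact: XF Fi].
rewrite ZE !measure_bigcup_finType //; first last.
- by move=> i j w /andP[pi _] /andP[pj _]; exact: tF.
- by move=> i /andP[pi _]; exact: mF.
have [p0|/card_gt0P[i0 pi0]] := posnP #|p|.
  have pF := card0_eq p0.
  have {}pF i : p i = false by exact: pF.
  by rewrite !big_pred0 ?mule0 // => i; rewrite pF.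
have qfin : q \is a fin_num by rewrite -(muF _ pi0) fin_num_measure //; exact: mF.
rewrite (eq_bigr (fun=> q)) => [|i /andP[pi _]]; last exact: muF.
rewrite [in RHS](eq_bigr (fun=> q)) => [|i pi]; last exact: muF.
rewrite -(fineK qfin) !sumEFin -EFinM !sumr_const; congr EFin.
rewrite /uniform_pushforward -natr_sum -big_mkcondr /= sum1_card.
rewrite -!(mulr_natl (fine q)) mulrA divfK //.
by rewrite pnatr_eq0 -lt0n; apply/card_gt0P; exists i0.
Qed.

End UniformOn.

(** Reduces a conditional probability to an identity on the fibres of a countably valued [Y]: there
    [f] is constant, and its integral is a product. *)
Lemma is_cond_prob_factor d (T : measurableType d) (R : realType)
    (P : probability T R) (G : set (set T)) (E : set T) (C : countType)
    (Y : T -> C) (f : T -> R) :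
  G `<=` measurable -> measurable E ->
  (forall w0, <<s G >> [set w | Y w = Y w0]) ->
  (forall w w', Y w = Y w' -> f w = f w') ->
  (forall w, 0 <= f w <= 1) ->
  (forall A w0, <<s G >> A ->
     P (A `&` [set w | Y w = Y w0] `&` E) =
     ((f w0)%:E * P (A `&` [set w | Y w = Y w0]))%E) ->
  is_cond_prob P <<s G >> E f.
Proof.
move=> Gm mE GY fY f01 PE.
have sGm : <<s G >> `<=` measurable.
  by apply: smallest_sub => //; exact: sigma_algebra_measurable.
have Gf B : <<s G >> (f @^-1` B).
  apply: (@measurable_factor _ (g_sigma_algebraType G) C Y GY) => w w' /fY.
  by rewrite /preimage /= => ->.
have mf : measurable_fun setT f.
  by move=> _ B mB; rewrite setTI; apply: sGm.
split=> [B mB|| A GA]; first exact: Gf.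
  apply: measurable_bounded_integrable => //.
    exact: le_lt_trans (probability_le1 P measurableT) (ltry 1).
  exists 1; split; first exact: num_real.
  move=> x x1 w _ /=; case/andP: (f01 w) => f0 f1.
  by rewrite ger0_norm // (le_trans f1) // ltW.
(* The fibres of [Y], indexed by their codes, form a countable partition along which both sides are
   summed. *)
pose Z k := [set w | pickle (Y w) = k].
have GZ k : <<s G >> (Z k).
  apply: (@measurable_factor _ (g_sigma_algebraType G) C Y GY) => w w' eY.
  by rewrite /Z /= eY.
have tZ (B : set T) : trivIset setT (fun k => B `&` Z k).
  by move=> i j _ _ [w [[_ <-] [_ <-]]].
have ZU (B : set T) : B = \bigcup_k (B `&` Z k).
  by apply/seteqP; split=> [w Bw|w [k _ []]//]; exists (pickle (Y w)).
rewrite [in LHS](ZU A) ge0_integral_bigcup //; first last.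
- by move=> w _; rewrite lee_fin; case/andP: (f01 w).
- apply: (@measurable_funS _ _ _ _ setT) => //; exact/measurable_EFinP.
- by move=> k; apply: measurableI; apply: sGm.
rewrite [in RHS](ZU (A `&` E)) measure_bigcup //; last first.
  by move=> k _; apply: measurableI; [apply: measurableI => //|]; apply: sGm.
rewrite [RHS]eseries_mkcond; apply: eq_eseriesr => k _; rewrite mem_setT.
have [[w0 kw0]|Zk0] := pselect (exists w, Z k w); last first.
  have -> : Z k = set0 by apply/seteqP; split=> // w ?; case: Zk0; exists w.
  by rewrite !setI0 integral_set0 measure0.
have ZE : Z k = [set w | Y w = Y w0].
  apply/seteqP; split=> w; rewrite /Z /=; first by rewrite -kw0 => /(pcan_inj pickleK).
  by move=> ->.
rewrite setIAC ZE; apply: etrans (esym (PE _ _ GA)).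
rewrite -integral_cst; last by rewrite -ZE; apply: measurableI; apply: sGm.
by apply: eq_integral => w; rewrite inE => -[_ /= /fY ->].
Qed.

(** * The law of the choices given the edge counts *)

Section History.
Context d (T : measurableType d).
Variables (m : nat -> {mfun T >-> nat}) (v : nat -> nat -> {mfun T >-> nat}).

Definition counts_agree (n : nat) (a : nat -> nat) : set T :=
  [set w | forall t, (0 < t <= n)%N -> m t w = a t].

(** All counts up to [n] are fixed from the start, while the choices are revealed one at a time, up
    to the last one before the [i]-th edge of [v_t]. *)
Definition history (n : nat) (a : nat -> nat) (u : nat -> nat -> nat)
    (t i : nat) : set T :=
  counts_agree n a `&`
  [set w | forall s l, (1 < s)%N && (0 < l <= a s)%N &&
     ((s < t) || (s == t) && (l < i))%N -> v s l w = u s l].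

Lemma count_events_counts_agree n a : <<s count_events m >> (counts_agree n a).
Proof.
apply: (@measurable_forall _ (g_sigma_algebraType (count_events m))) => t.
apply: (@measurable_imply _ (g_sigma_algebraType (count_events m))).
by case/andP => t0 _; apply: sub_sigma_algebra; exists t, (a t).
Qed.

Lemma count_events_past t i : <<s count_events m >> `<=` past m v t i.
Proof.
apply: smallest_sub; first exact: smallest_sigma_algebra.
by move=> B GB; apply: sub_sigma_algebra; left.
Qed.

Lemma past_history n a u t i : (t <= n)%N -> past m v t i (history n a u t i).
Proof.
move=> tn; rewrite /past; set G := _ `|` _.
(* The generators of [past] mention a choice only together with the existence of its edge; the fixed
   counts, which reach [t] since [t <= n], supply that existence. *)
have -> : history n a u t i = counts_agree n a `&`
    [set w | forall s l, (1 < s)%N && (0 < l <= a s)%N &&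
       ((s < t) || (s == t) && (l < i))%N -> (l <= m s w)%N /\ v s l w = u s l].
  apply/seteqP; split=> w [ma vu]; split=> // s l hsl; last by case: (vu s l hsl).
  split; last exact: vu.
  rewrite ma //; first by case/andP: hsl => /andP[_ /andP[]].
  by move: hsl => /andP[/andP[s1 _] /orP[|/andP[/eqP]]]; lia.
apply: (@measurableI _ (g_sigma_algebraType G)).
  by apply: count_events_past; exact: count_events_counts_agree.
apply: (@measurable_forall _ (g_sigma_algebraType G)) => s.
apply: (@measurable_forall _ (g_sigma_algebraType G)) => l.
apply: (@measurable_imply _ (g_sigma_algebraType G)).
case/andP => /andP[s1 /andP[l0 la]] hst; apply: sub_sigma_algebra; right.
exists s, l, (u s l); split=> //.
by case/orP: hst => [|/andP[/eqP]]; [left|right].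
Qed.

Lemma measurable_mfun_eq (f : {mfun T >-> nat}) k : measurable [set w | f w = k].
Proof. exact: (measurable_funPTI f (Y := [set k])). Qed.

Lemma count_events_measurable : <<s count_events m >> `<=` measurable.
Proof.
apply: smallest_sub; first exact: sigma_algebra_measurable.
by move=> _ [t [k [_ ->]]]; exact: measurable_mfun_eq.
Qed.

Lemma measurable_history n a u t i : measurable (history n a u t i).
Proof.
apply: measurableI.
  by apply: count_events_measurable; exact: count_events_counts_agree.
apply: measurable_forall => s; apply: measurable_forall => l.
by apply: measurable_imply => _; exact: measurable_mfun_eq.
Qed.

(** Before the first edge of vertex [n + 1], all choices up to time [n] have been revealed. *)
Lemma historyP n a u w : history n a u n.+1 1 w <->
  agree n a (m ^~ w) u (fun t i => v t i w).
Proof.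
split=> [[ma vu]|[am uv]].
  split=> [t /ma //|t i /andP[t1 tn] hi]; rewrite vu // t1 hi /=.
  by rewrite ltnS tn.
split=> [t /am //|s l /andP[/andP[s1 hl] hs]]; rewrite uv // s1 /=.
by case/orP: hs => [|/andP[/eqP-> ]]; lia.
Qed.

Variables (R : realType) (P : probability T R) (delta : R).
Hypothesis v_PA : affine_PA P delta m v.
Variables (n : nat) (a : nat -> nat) (u : nat -> nat -> nat).
Hypothesis u_lt : forall t i, (1 < t)%N -> (u t i < t)%N.
Variable A : set T.
Hypothesis mA : <<s count_events m >> A.

(** The conditional probability of the next choice is integrated over a past event on which the
    weight is constant. *)
Lemma measure_historyS t i : (1 < t <= n)%N -> (0 < i <= a t)%N ->
  P (A `&` history n a u t i.+1) =
  ((PAweight delta a u t i.-1 (u t i))%:E * P (A `&` history n a u t i))%E.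
Proof.
move=> /andP[t1 tn] /andP[i0 ia].
have [_ _ /(_ (A `&` history n a u t i))] := v_PA t1 i0 (u_lt i t1).
have pB : past m v t i (A `&` history n a u t i).
  rewrite /past; set G := _ `|` _.
  apply: (@measurableI _ (g_sigma_algebraType G)); last exact: past_history.
  exact: count_events_past.
move=> /(_ pB) /esym.
have -> : A `&` history n a u t i `&` [set w | (i <= m t w)%N /\ v t i w = u t i]
    = A `&` history n a u t i.+1.
  rewrite -setIA; congr (A `&` _); apply/seteqP; split.
    move=> w [[ma vu] [_ vuti]]; split=> // s l hsl.
    have [sl|] := boolP ((s < t) || (s == t) && (l < i))%N.
      by apply: vu; case/andP: hsl => -> _.
    move: hsl => /andP[_ /orP[->//|/andP[/eqP-> li]]].
    rewrite ltnn eqxx /= -leqNgt => il.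
    by have -> : l = i by lia.
  move=> w [ma vu]; split; last first.
    split; first by rewrite ma // tn (ltnW t1).
    by apply: vu; rewrite t1 i0 ia eqxx ltnSn orbT.
  split=> // s l /andP[hsl hst]; apply: vu; rewrite hsl /=.
  by case/orP: hst => [->//|/andP[-> li]]; rewrite ltnS (ltnW li) orbT.
move=> ->; rewrite -integral_cst; last first.
  by apply: measurableI; [exact: count_events_measurable|exact: measurable_history].
apply: eq_integral => w; rewrite inE => -[_ [ma vu]] /=.
rewrite ma ?tn ?(ltnW t1) // ia; congr EFin; rewrite /PAweight.
(* The weight sees the past only through the current network, which the history determines. *)
suff -> : PAstep (m ^~ w) (fun s l => v s l w) t i.-1 = PAstep a u t i.-1 by [].
apply/esym/eq_PAstep => [|l hl].
  split=> [s hs|s l /andP[s1 st] hl]; first by rewrite ma //; lia.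
  by rewrite vu // s1 hl; apply/orP; left; lia.
by rewrite vu // t1 eqxx; lia.
Qed.

Lemma measure_history :
  P (A `&` history n a u n.+1 1) =
  ((\prod_(2 <= t < n.+1) \prod_(1 <= i < (a t).+1)
      PAweight delta a u t i.-1 (u t i))%:E * P (A `&` counts_agree n a))%E.
Proof.
suff H t : (1 < t <= n.+1)%N -> P (A `&` history n a u t 1) =
  ((\prod_(2 <= s < t) \prod_(1 <= i < (a s).+1)
      PAweight delta a u s i.-1 (u s i))%:E * P (A `&` counts_agree n a))%E.
  have [|n0] := ltnP 1 n.+1; first by move=> n1; apply: H; rewrite n1 /=.
  rewrite big_geq ?mul1e; last by lia.
  congr (P (A `&` _)); apply/setIidl => w _ s l /= hsl; exfalso.
  by lia.
elim: t => // t IH; rewrite ltnS leq_eqVlt => /andP[/predU1P[<-|t1] tn].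
  rewrite big_geq // mul1e; congr (P (A `&` _)); apply/setIidl => w _ s l /=.
  by move=> hsl; exfalso; lia.
(* The time before the first edge of [v_{t+1}] is the time after the last edge of [v_t]. *)
have hE : history n a u t.+1 1 = history n a u t (a t).+1.
  congr (_ `&` _); apply/seteqP; split=> w h s l hsl; apply: h.
    by case: (eqVneq s t) hsl => [->|]; lia.
  by case: (eqVneq s t) hsl => [->|]; lia.
have step i : (i <= a t)%N -> P (A `&` history n a u t i.+1) =
    ((\prod_(1 <= l < i.+1) PAweight delta a u t l.-1 (u t l))%:E *
     P (A `&` history n a u t 1))%E.
  elim: i => [|i IHi] ia; first by rewrite big_geq // mul1e.
  rewrite measure_historyS ?t1 ?ltnS // IHi; last exact: ltnW.
  by rewrite muleA -EFinM [in RHS]big_nat_recr //= [in RHS]mulrC.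
rewrite hE step // IH; last by rewrite t1 ltnW.
by rewrite [in RHS]big_nat_recr //= muleA -EFinM [in RHS]mulrC.
Qed.

End History.

(** * The conditional law of the observation *)

Section Targets.
Variables (n N : nat) (a : nat -> nat).

(** A finite type for the choices up to time [n], so that they can be counted; [N] stands for a
    bound on the edge counts. *)
Definition target_code := {ffun 'I_n.+1 * 'I_N.+1 -> 'I_n.+1}.

Definition targets (y : target_code) (t i : nat) : nat := y (inord t, inord i).

(* The entries that encode no edge are set to 0, so that a sequence of choices
   has exactly one code; since [inord] sends out-of-range indices to 0,
   [targets y] is 0 there as well when [t > n]. *)
Definition admissible (y : target_code) : bool :=
  [forall p : 'I_n.+1 * 'I_N.+1, if [&& 1 < p.1, 0 < p.2 & p.2 <= a p.1]%N
             then (y p < p.1)%N else y p == ord0].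

Lemma targets_lt y t i : admissible y -> (1 < t)%N -> (targets y t i < t)%N.
Proof.
move=> /forallP/(_ (inord t, inord i)) /= + t1.
case: ifP => [_ ylt|_ /eqP y0]; last by rewrite /targets y0 ltnW.
apply: leq_trans ylt _; have [tn|tn] := ltnP t n.+1; first by rewrite inordK.
by rewrite (leq_trans (ltnW (ltn_ord _))).
Qed.

Lemma targets_inj y z : admissible y -> admissible z ->
  (forall t i, (1 < t <= n)%N -> (0 < i <= a t)%N ->
     targets y t i = targets z t i) -> y = z.
Proof.
move=> /forallP ay /forallP az yz; apply/ffunP => p; apply: val_inj.
have := az p; have := ay p; case: ifP => [|_ /eqP-> /eqP->//].
move=> /and3P[p1 p20 p2a] _ _.
have := yz p.1 p.2; rewrite /targets !inord_val -surjective_pairing; apply.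
  by rewrite p1 -ltnS ltn_ord.
by rewrite p20.
Qed.

Lemma targets_surj u : (forall t, (t <= n)%N -> (a t <= N)%N) ->
  (forall t i, (1 < t)%N -> (u t i < t)%N) ->
  exists2 y, admissible y &
    forall t i, (1 < t <= n)%N -> (0 < i <= a t)%N -> targets y t i = u t i.
Proof.
move=> aN ult.
pose y : target_code := [ffun p : 'I_n.+1 * 'I_N.+1 =>
  if [&& 1 < p.1, 0 < p.2 & p.2 <= a p.1]%N
  then inord (u p.1 p.2) else ord0].
exists y => [|t i /andP[t1 tn] /andP[i0 ia]].
  apply/forallP => p; rewrite ffunE.
  case: ifP => hp; case: ifP => hq //; last first.
  - by have := etrans (esym hq) hp.
  - by case/and3P: hp => /ltnW.
  have [p1 _ _] := and3P hp.
  rewrite inordK ?ult //.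
  by rewrite (leq_trans (ult _ _ p1)) // ltnW // ltn_ord.
have iN : (i < N.+1)%N by rewrite ltnS (leq_trans ia) // aN.
rewrite /targets ffunE /= (inordK (n' := n)) // (inordK (n' := N)) //.
rewrite t1 i0 ia /=.
by rewrite inordK // (leq_trans (ult _ _ t1)) // ltnW.
Qed.

End Targets.

(** Sorting gives a canonical representative of the multiset of observed degrees, so that equality
    of multisets becomes equality in a countable type. *)
Definition profile (n : nat) (a : nat -> nat) (u : nat -> nat -> nat) : seq nat :=
  sort leq (flatten (observation n a u)).

Lemma eq_profile n a b u v : agree n a b u v -> profile n a u = profile n b v.
Proof. by move=> abuv; rewrite /profile (eq_observation abuv). Qed.

(* The default 1 keeps all edge counts positive. *)
Definition counts_of (s : seq nat) (t : nat) : nat := nth 1%N s t.-1.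

(** [c] pairs the edge counts with a profile; [sumn c.1] serves as the bound on the counts. This is
    the finite set carrying the uniform law. *)
Definition profile_class (n : nat) (c : seq nat * seq nat) :
    pred (target_code n (sumn c.1)) :=
  fun y => admissible (counts_of c.1) y &&
    (profile n (counts_of c.1) (targets y) == c.2).

Definition observation_kernel (R : realType) (n : nat) (c : seq nat * seq nat)
    (x : seq (seq nat)) : R :=
  uniform_pushforward R (@profile_class n c)
    (fun y => observation n (counts_of c.1) (targets y)) x.

Lemma mkseq_eqP (C : eqType) (f g : nat -> C) n :
  mkseq f n = mkseq g n <-> forall i, (i < n)%N -> f i = g i.
Proof.
split=> [fg i i_n|fg]; last first.
  by apply/eq_in_map => i; rewrite mem_iota => /fg.
by rewrite -(nth_mkseq (f 0%N) f i_n) fg nth_mkseq.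
Qed.

Lemma leq_nth_sumn s i : (nth 0%N s i <= sumn s)%N.
Proof.
elim: s i => [|x s IH] [|i] //=; first exact: leq_addr.
exact: leq_trans (IH i) (leq_addl _ _).
Qed.

Section Model.
Context d (T : measurableType d).
Variables (m : nat -> {mfun T >-> nat}) (v : nat -> nat -> {mfun T >-> nat}).
Hypothesis m_gt0 : forall t w, (0 < t)%N -> (0 < m t w)%N.
Hypothesis v_lt : forall t i w, (1 < t)%N -> (v t i w < t)%N.
Variable n : nat.
Hypothesis n_gt0 : (0 < n)%N.

Let X w := observation n (m ^~ w) (fun t i => v t i w).
Let S k w := num_deg_gt n (m ^~ w) (fun t i => v t i w) k.+1.

Lemma measurable_agree (Q : set T) :
  (forall w w', agree n (m ^~ w) (m ^~ w') (fun t i => v t i w)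
     (fun t i => v t i w') -> Q w -> Q w') -> measurable Q.
Proof.
move=> Qagree.
(* Cutting each row of choices at its own edge count records all that matters up to time [n] in a
   countable type. *)
pose Y w := (mkseq (m ^~ w) n.+1,
             mkseq (fun t => mkseq (fun i => v t i w) (m t w).+1) n.+1).
have YP w w' : Y w = Y w' <-> forall t, (t < n.+1)%N -> m t w = m t w' /\
    forall i, (i < (m t w').+1)%N -> v t i w = v t i w'.
  split=> [eqY t tn|eqmv].
    have [/mkseq_eqP eqm /mkseq_eqP eqv] :
      (Y w).1 = (Y w').1 /\ (Y w).2 = (Y w').2 by rewrite eqY.
    by split; [exact: eqm|apply/mkseq_eqP; rewrite -eqv // eqm].
  congr pair; apply/mkseq_eqP => t /eqmv[eqm eqv] //.
  by rewrite eqm; apply/mkseq_eqP.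
apply: (@measurable_factor _ _ _ Y) => [w0|w w' /YP eqmv].
  rewrite (_ : mkset _ = [set w | forall t, (t < n.+1)%N -> m t w = m t w0 /\
      forall i, (i < (m t w0).+1)%N -> v t i w = v t i w0]); last first.
    by apply/seteqP; split=> w /YP.
  apply: measurable_forall => t; apply: measurable_imply => _.
  apply: measurableI; first exact: measurable_mfun_eq.
  apply: measurable_forall => i; apply: measurable_imply => _.
  exact: measurable_mfun_eq.
apply: Qagree; split=> [t /andP[_ tn]|t i /andP[_ tn] /andP[_ im]].
  by case: (eqmv t).
by case: (eqmv t) => // eqm; apply; rewrite ltnS -eqm.
Qed.

Definition counts_profile w : seq nat * seq nat :=
  (mkseq (fun t => m t.+1 w) n, profile n (m ^~ w) (fun t i => v t i w)).

Lemma counts_of_counts_profile w t : (0 < t <= n)%N ->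
  counts_of (counts_profile w).1 t = m t w.
Proof. by case: t => // t tn; rewrite /counts_of nth_mkseq. Qed.

(** With equal counts, [perm_observationP] identifies equal multisets with equal statistics; hence
    [counts_profile] is a countable code of what is conditioned on. *)
Lemma counts_profileP w w' : counts_profile w = counts_profile w' <->
  (forall t, (0 < t <= n)%N -> m t w = m t w') /\ forall k, S k w = S k w'.
Proof.
have eqS : (forall t, (0 < t <= n)%N -> m t w = m t w') ->
  (counts_profile w).2 = (counts_profile w').2 <-> forall k, S k w = S k w'.
  move=> eqm; rewrite -perm_observationP //; try by move=> t; auto.
  by split=> /(perm_sortP leq_total leq_trans anti_leq).
split=> [eqY|[eqm eqSk]].
  have eqm t : (0 < t <= n)%N -> m t w = m t w'.
    by move=> tn; rewrite -!counts_of_counts_profile // eqY.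
  by split=> //; apply/eqS => //; rewrite eqY.
rewrite [LHS]surjective_pairing [RHS]surjective_pairing; congr pair; last exact/eqS.
by apply/mkseq_eqP => t tn; apply: eqm.
Qed.

Let G := count_events m `|` stat_events S.

Lemma count_stat_events_counts_profile w0 :
  <<s G >> [set w | counts_profile w = counts_profile w0].
Proof.
rewrite (_ : mkset _ = counts_agree m n (m ^~ w0) `&`
    [set w | forall k, S k w = S k w0]); last first.
  by apply/seteqP; split=> w /counts_profileP.
apply: (@measurableI _ (g_sigma_algebraType G)).
  apply: (@measurable_forall _ (g_sigma_algebraType G)) => t.
  apply: (@measurable_imply _ (g_sigma_algebraType G)) => /andP[t0 _].
  by apply: sub_sigma_algebra; left; exists t, (m t w0).
apply: (@measurable_forall _ (g_sigma_algebraType G)) => k.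
by apply: sub_sigma_algebra; right; exists k, (S k w0).
Qed.

Lemma count_stat_events_measurable : G `<=` measurable.
Proof.
move=> _ [[t [k [_ ->]]]|[k [j ->]]]; first exact: measurable_mfun_eq.
by apply: measurable_agree => w w' /eq_num_deg_gt eqS; rewrite /S /= eqS.
Qed.

Section Cell.
Variable w0 : T.
Let c := counts_profile w0.
Let a := counts_of c.1.

Lemma counts_of_leq_sumn t : (t <= n)%N -> (a t <= sumn c.1)%N.
Proof.
(* For [t = 0] the index read is again 0, in range because [n] is positive; so the default 1 of
   [counts_of] never occurs here. *)
move=> tn; have ts : (t.-1 < size c.1)%N by rewrite size_mkseq; lia.
by rewrite /a /counts_of (set_nth_default 0%N) // leq_nth_sumn.
Qed.

(** With [profile_class_history], this makes the cell of [w0] the union of the full histories coded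
    by [profile_class]. *)
Lemma profile_class_surj w : counts_profile w = c ->
  exists2 y, @profile_class n c y & history m v n a (targets y) n.+1 1 w.
Proof.
move=> wc.
have [y ay yv] := targets_surj counts_of_leq_sumn (fun t i => v_lt i w).
have agr : agree n a (m ^~ w) (targets y) (fun t i => v t i w).
  by split=> // t tn; rewrite /a -wc counts_of_counts_profile.
exists y; last exact/historyP.
by rewrite /profile_class ay (eq_profile agr) -wc eqxx.
Qed.

Lemma profile_class_card_gt0 : (0 < #|@profile_class n c|)%N.
Proof.
have [y yc _] := profile_class_surj (erefl c).
by apply/card_gt0P; exists y.
Qed.

Lemma profile_class_history y w : @profile_class n c y ->
  history m v n a (targets y) n.+1 1 w -> counts_profile w = c.
Proof.
move=> /andP[_ /eqP yc] /historyP agr; rewrite [RHS]surjective_pairing -yc.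
rewrite (eq_profile agr); congr pair; apply/mkseq_eqP => t tn.
have := proj1 agr t.+1 tn; rewrite /a /c counts_of_counts_profile //; exact: esym.
Qed.

Lemma cell_observation (R : realType) (P : probability T R) (delta : R)
    (A : set T) x :
  affine_PA P delta m v -> <<s G >> A ->
  P (A `&` [set w | counts_profile w = c] `&` [set w | X w = x]) =
  ((observation_kernel R n c x)%:E *
   P (A `&` [set w | counts_profile w = c]))%E.
Proof.
move=> v_PA GA.
(* The statistic is constant on the cell, so [A] can be replaced there by an event [B] about the
   counts alone, as [measure_history] requires. *)
have [B mB ->] : exists2 B, <<s count_events m >> B &
    A `&` [set w | counts_profile w = c] = B `&` [set w | counts_profile w = c].
  move: A GA; apply: g_sigma_algebra_trace => _ [k [j ->]].
  have [Sj|Sj] := eqVneq (S k w0) j; [right|left].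
    by move=> w /counts_profileP[_ eqS] /=; rewrite eqS.
  apply/seteqP; split=> // w [/= Swj /counts_profileP[_ eqS]].
  by move: Sj; rewrite -Swj eqS eqxx.
pose W := \prod_(2 <= t < n.+1) \prod_(1 <= i < (a t).+1)
    (((\sum_(1 <= s < t) a s).*2 + i.-1)%:R + t%:R * delta)^-1.
(* The pieces are the histories of the codes in the class. Their common mass [q] involves the
   choices only through the profile [c.2], and [W] only involves the counts. *)
apply: (measure_uniform_pushforward
  (F := fun y => B `&` history m v n a (targets y) n.+1 1)
  (q := ((\prod_(k <- c.2) (k%:R + delta) * W)%:E * P (B `&` counts_agree m n a))%E)).
- move=> y _; apply: measurableI; last exact: measurable_history.
  exact: count_events_measurable mB.
- move=> y z w /andP[ay _] /andP[az _] [_ /historyP[_ yv]] [_ /historyP[_ zv]].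
  by apply: (targets_inj ay az) => t i ht hi; rewrite yv // zv.
- move=> y /andP[ay /eqP yc].
  have ylt t i : (1 < t)%N -> (targets y t i < t)%N := targets_lt i ay.
  apply: (etrans (measure_history v_PA n a ylt mB)).
  rewrite PAweight_observation // -/W -yc.
  by congr ((_ * _)%:E * _)%E; apply: perm_big; rewrite perm_sym perm_sort.
- by move=> y w _ [_ /historyP agr]; rewrite (eq_observation agr).
- apply/seteqP; split=> [w [Bw /profile_class_surj[y yc hy]]|w [y yc [Bw hy]]].
    by exists y.
  by split=> //; exact: profile_class_history hy.
Qed.

End Cell.

Lemma sufficient_num_deg_gt (R : realType) (P : R -> probability T R)
    (Theta : set R) :
  (forall delta, Theta delta -> affine_PA (P delta) delta m v) ->
  sufficient_given Theta P m X S.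
Proof.
move=> v_PA; split.
  (* The sequence [b] is the counts shifted to start at index 0, hence [b t.-1] for the count of
     [v_t]. *)
  exists (fun b x k => (num_initial_gt (fun t => b t.-1) n k.+1
    + count_mem k.+1 (flatten x))%N) => w k.
  rewrite /S num_deg_gt_observation // /num_initial_gt; last by move=> t i; exact: v_lt.
  congr (_ + _ + _)%N; rewrite !big_nat; apply: eq_bigr => t /andP[t1 _].
  by rewrite prednK // ltnW.
(* The kernel at [w] is the image of the uniform law on the class of [w]; that class contains the
   code of the actual choices, so the total mass is 1. *)
exists (fun w => observation_kernel R n (counts_profile w)); split=> [w x|w|delta].
- exact: uniform_pushforward_ge0.
- exact/esum_uniform_pushforward/profile_class_card_gt0.
- move=> /v_PA PA_delta x; apply: (is_cond_prob_factor (Y := counts_profile)).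
  + exact: count_stat_events_measurable.
  + by apply: measurable_agree => w w' /eq_observation eqX; rewrite /X /= eqX.
  + exact: count_stat_events_counts_profile.
  + by move=> w w' ->.
  + by move=> w; rewrite uniform_pushforward_ge0 uniform_pushforward_le1.
  + by move=> A w0 GA; exact: cell_observation PA_delta GA.
Qed.

End Model.

Theorem mainTheorem5 (R : realType) (d : measure_display)
    (T : measurableType d) (P : R -> probability T R) (mu : probability nat R)
    (m : nat -> {mfun T >-> nat}) (v : nat -> nat -> {mfun T >-> nat})
    (m_gt0 : forall t w, (0 < t)%N -> (0 < m t w)%N)
    (v_lt : forall t i w, (1 < t)%N -> (v t i w < t)%N)
    (m_iid : forall delta : R, -1 < delta -> iid_counts (P delta) mu m)
    (v_PA : forall delta : R, -1 < delta -> affine_PA (P delta) delta m v)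
    (n : nat) (n_ge2 : (2 <= n)%N) :
  sufficient_given [set delta : R | -1 < delta] P m
    (fun w => observation n (m ^~ w) (fun t i => v t i w))
    (fun k w => num_deg_gt n (m ^~ w) (fun t i => v t i w) k.+1).
Proof.
by apply: (sufficient_num_deg_gt m_gt0 v_lt (ltnW n_ge2)) => delta; exact: v_PA.
Qed.
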